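(* Let $X_\phi$ be a substitution tiling system in $\mathbb{R}^m$ such that for every $a\in\mathcal{A}$ there exists $n_a>0$ such that $\phi^{n_a}a$ contains a tile $a'$ of the same type as $a$ and parallel to $a$. Then $\mathcal{O}_j(x)=\mathcal{O}_k(x)$ for every tiling $x\in X_\phi$ and all tile types $j$ and $k$.
   Context: $G_E$ is the connected Euclidean group of $\mathbb{R}^m$, the semidirect product of $SO(m)$ with $\mathbb{R}^m$; $g=(r,t)$ denotes the rotation $r$ about the origin followed by translation by $t$, and $T^g$ denotes its action on tiles, patches and tilings. Substitution tiling systems. $\mathcal{A}$ (the alphabet) is a nonempty finite collection of polyhedra in $\mathbb{R}^m$ (polygons if $m=2$), distinct elements not being congruent under $G_E$. A tile is a copy $T^g b$ ($g\in G_E$) of some $b\in\mathcal{A}$; $b$ is its type. $X(\mathcal{A})$ is the set of all tilings of $\mathbb{R}^m$ by tiles. Congruent means congruent under $G_E$. A patch is a (finite or infinite) subset of a tiling in $X(\mathcal{A})$; $W$ is the set of all patches. A substitution function is a map $\phi:W\to W$ which acts simultaneously on all tiles of a patch by subdividing and stretching about the origin (so $\phi P=\bigcup_{a\in P}\phi a$), such that: (i) there is a constant $|\phi|>1$ such that $\phi(T^g x)=T^{\phi(g)}(\phi x)$ for all $g\in G_E$ and patches $x$, where $\phi(g)$ is the conjugate of $g$ by the similarity stretching about the origin by $|\phi|$ (so $\phi((r,t))=(r,|\phi|t)$); (ii) for each tile $a\in\mathcal{A}$ and $n\ge1$, the union of the tiles in $\phi^n a$ is congruent to $|\phi|^n a$,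 and these tiles meet full face to full face; (iii) for each $a\in\mathcal{A}$, $\phi a$ contains at least one tile of each type. The substitution tiling system $X_\phi\subset X(\mathcal{A})$ is the set of tilings $x$ such that every finite subpatch of $x$ is congruent to a subpatch of $\phi^n a$ for some $n>0$ and $a\in\mathcal{A}$. Two tiles of the same type are parallel if one is a translate of the other. For a tiling $x$ and tile $a\in x$ of type $j$, $R_j(a,x)\subset SO(m)$ is the set of rotations bringing some tile of type $j$ in $x$ parallel to $a$; the group it generates does not depend on the choice of $a$ and is denoted $\mathcal{O}_j(x)$. *)

(* Defs.v *)
(* R^m is 'cV[R]_m, for an arbitrary R : realType. *)
From HB Require Import structures.
From mathcomp Require Import all_boot all_order all_algebra.
From mathcomp Require Import all_classical all_reals all_analysis.
Set Implicit Arguments.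
Unset Strict Implicit.
Unset Printing Implicit Defensive.
Import Order.TTheory GRing.Theory Num.Theory.
Import numFieldNormedType.Exports.
Local Open Scope classical_set_scope.
Local Open Scope ring_scope.

Section Defs.
Variables (R : realType) (m : nat).

Implicit Types (u v x : 'cV[R]_m) (r s : 'M[R]_m) (B C F H : set 'cV[R]_m).

(* An element (r, t) of G_E is the rotation r followed by the translation t. *)
Definition SO : set 'M[R]_m := [set r | r *m r^T = 1%:M /\ \det r = 1].

Definition motion : Type := ('M[R]_m * 'cV[R]_m)%type.

Definition GE : set motion := [set g | SO g.1].

Definition move (g : motion) v : 'cV[R]_m := g.1 *m v + g.2.

(* The conjugate of g by the similarity stretching by l about the origin. *)
Definition stretch (l : R) (g : motion) : motion := (g.1, l *: g.2).

Definition convex_hull k (p : 'I_k -> 'cV[R]_m) : set 'cV[R]_m :=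
  [set x | exists w : 'I_k -> R,
    [/\ forall i, 0 <= w i, \sum_i w i = 1 & x = \sum_i w i *: p i]].

Definition hyperplane u (c : R) : set 'cV[R]_m :=
  [set x | \sum_i u i 0 * x i 0 = c].

(* Interior relative to H. *)
Definition rel_interior H B : set 'cV[R]_m :=
  [set x | H x /\ within H (nbhs x) B].

(* B is a not necessarily convex polytope, of full dimension in H. *)
Definition polytope_in H B : Prop :=
  exists n (C : 'I_n.+1 -> set 'cV[R]_m),
    (forall i, [/\ exists k (p : 'I_k -> 'cV[R]_m), C i = convex_hull p,
                   C i `<=` H & rel_interior H (C i) !=set0])
    /\ B = \bigcup_i C i.

(* The intersection of F1 and F2 has dimension m - 1. *)
Definition facing F1 F2 : Prop :=
  exists u c, u != 0 /\ rel_interior (hyperplane u c) (F1 `&` F2) !=set0.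

(* A polyhedron comes with its (m-1)-dimensional faces. These subdivide the
   boundary, but a maximal flat part of the boundary may consist of several
   faces: for instance, the pinwheel substitution is only edge to edge once an
   extra vertex is put on the long leg of the triangle. *)
Record polyhedron := Polyhedron {
  body : set 'cV[R]_m ;
  faces : set (set 'cV[R]_m) }.

Definition is_polyhedron (b : polyhedron) : Prop :=
  [/\ polytope_in setT (body b),
      finite_set (faces b),
      forall F, faces b F ->
        exists u c, u != 0 /\ polytope_in (hyperplane u c) F,
      \bigcup_(F in faces b) F = body b `\` interior (body b) &
      forall F1 F2, faces b F1 -> faces b F2 -> facing F1 F2 -> F1 = F2].

(* T^g on tiles, and on patches and tilings (which are sets of tiles). *)
Definition Tact (g : motion) (b : polyhedron) : polyhedron :=
  Polyhedron (move g @` body b) ((fun F => move g @` F) @` faces b).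

Definition Tpatch (g : motion) (P : set polyhedron) : set polyhedron :=
  Tact g @` P.

Implicit Types (A P y : set polyhedron) (a b t j k : polyhedron).

Definition alphabet A : Prop :=
  [/\ A !=set0, finite_set A, forall a, A a -> is_polyhedron a &
      forall a b g, A a -> A b -> GE g -> b = Tact g a -> a = b].

(* t is a tile of type b. *)
Definition has_type b t : Prop := exists2 g, GE g & t = Tact g b.

(* X(A) *)
Definition tiling A y : Prop :=
  [/\ forall t, y t -> exists2 b, A b & has_type b t,
      \bigcup_(t in y) body t = setT &
      forall t1 t2, y t1 -> y t2 -> t1 <> t2 ->
        interior (body t1) `&` interior (body t2) = set0].

(* W *)
Definition patch A P : Prop := exists2 y, tiling A y & P `<=` y.

Definition support P : set 'cV[R]_m := \bigcup_(t in P) body t.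

Definition full_face_to_full_face P : Prop :=
  forall t1 t2 F1 F2, P t1 -> P t2 -> t1 <> t2 ->
    faces t1 F1 -> faces t2 F2 -> facing F1 F2 -> F1 = F2.

(* The map phi : W -> W is totalized; its values outside of W are irrelevant.
   For a in A, phi a stands for phi [set a]; as soon as X(A) is nonempty, the
   conditions below make every such [set a] a patch. *)
Definition substitution A (l : R) (phi : set polyhedron -> set polyhedron)
    : Prop :=
  [/\ 1 < l,
      (forall P, patch A P -> patch A (phi P)) /\
      (forall P, patch A P -> phi P = \bigcup_(t in P) phi [set t]),
      forall g P, GE g -> patch A P ->
        phi (Tpatch g P) = Tpatch (stretch l g) (phi P),
      forall a n, A a -> (1 <= n)%N ->
        (exists2 g, GE g &
           support (iter n phi [set a]) =
           move g @` [set l ^+ n *: v | v in body a]) /\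
        full_face_to_full_face (iter n phi [set a]) &
      forall a b, A a -> A b -> exists2 t, phi [set a] t & has_type b t].

(* X_phi *)
Definition substitution_tiling A (phi : set polyhedron -> set polyhedron) y
    : Prop :=
  tiling A y /\
  forall P, finite_set P -> P `<=` y ->
    exists n a g,
      [/\ (0 < n)%N, A a, GE g & Tpatch g P `<=` iter n phi [set a]].

(* For tiles of the same type. *)
Definition parallel t1 t2 : Prop := exists v, t2 = Tact (1%:M, v) t1.

(* R_j(a, y) *)
Definition Rset j a y : set 'M[R]_m :=
  [set r | SO r /\
     exists t, [/\ y t, has_type j t & parallel (Tact (r, 0) t) a]].

Definition subgroup_SO (G : set 'M[R]_m) : Prop :=
  [/\ G `<=` SO, G 1%:M, forall r s, G r -> G s -> G (r *m s) &
      forall r, G r -> G (invmx r)].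

(* O_j(y), the group generated by R_j(a, y) for whichever tile a of type j;
   see Ogroup_indep. *)
Definition Ogroup j y : set 'M[R]_m :=
  [set r | exists a,
    [/\ y a, has_type j a & smallest subgroup_SO (Rset j a y) r]].

Lemma SO_unit r : SO r -> r \in unitmx.
Proof. by move=> [_ dr]; rewrite unitmxE dr unitr1. Qed.

Lemma SO_inv r : SO r -> invmx r = r^T.
Proof.
move=> rS; have ru := SO_unit rS; case: rS => rr _.
by rewrite -[LHS]mulmx1 -rr mulKmx.
Qed.

Lemma SO_subgroup : subgroup_SO SO.
Proof.
split=> //.
- by split; rewrite ?det1 // trmx1 mulmx1.
- move=> r s [rr dr] [ss ds]; split; last by rewrite det_mulmx dr ds mulr1.
  by rewrite trmx_mul mulmxA -(mulmxA r) ss mulmx1.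
- move=> r rS; split; last by rewrite det_inv; case: rS => _ ->; rewrite invr1.
  by rewrite (SO_inv rS) trmxK -(SO_inv rS) mulVmx // SO_unit.
Qed.

Lemma TactM g1 g2 t :
  Tact g1 (Tact g2 t) = Tact (g1.1 *m g2.1, g1.1 *m g2.2 + g1.2) t.
Proof.
have E C : move g1 @` (move g2 @` C) =
    move (g1.1 *m g2.1, g1.1 *m g2.2 + g1.2) @` C.
  rewrite image_comp; apply: eq_imagel => x _.
  by rewrite /move /= mulmxDr mulmxA addrA.
rewrite /Tact /= E; congr Polyhedron.
by rewrite image_comp; apply: eq_imagel => F _ /=; rewrite E.
Qed.

Lemma gen_subgroup (S : set 'M[R]_m) :
  S `<=` SO -> subgroup_SO (smallest subgroup_SO S).
Proof.
move=> SS; split.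
- exact: (smallest_sub SO_subgroup SS).
- by move=> G [[]].
- move=> r s Hr Hs G GP; case: (GP) => -[_ _ GM _] _.
  by exact: GM (Hr _ GP) (Hs _ GP).
- by move=> r Hr G GP; case: (GP) => -[_ _ _ GV] _; exact: GV (Hr _ GP).
Qed.

Lemma Ogroup_indep j a y : y a -> has_type j a ->
  Ogroup j y = smallest subgroup_SO (Rset j a y).
Proof.
move=> ya ja; apply/seteqP; split=> [r [a1 [ya1 ja1]]|r Hr]; last by exists a.
have RS : Rset j a y `<=` SO by move=> ? [].
apply: (smallest_sub (gen_subgroup RS)) => {r}.
have [_ S1 SM SV] := SO_subgroup.
case: (ja) => -[ra ta] /= Sra ea; case: (ja1) => -[r1 t1] /= Sr1 e1.
pose s := ra *m invmx r1.
have Ss : SO s by apply: SM => //; apply: SV.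
have sa : exists v, a = Tact (s, v) a1.
  exists (ta - s *m t1); rewrite ea e1 TactM /=.
  by rewrite addrC subrK /s mulmxKV // SO_unit.
have sR : Rset j a y s.
  split=> //; exists a1; split=> //; case: sa => v ->; exists v.
  by rewrite TactM /= mul1mx mulmx0 add0r.
move=> r [Sr [t [yt jt [v et]]]].
have srR : Rset j a y (s *m r).
  split; first exact: SM.
  exists t; split=> //; case: sa => w ->; exists (s *m v + w).
  by rewrite et !TactM /= !mul1mx !mulmx1 !mulmx0 !add0r.
move=> G [[_ _ GM GV] RG].
have -> : r = invmx s *m (s *m r) by rewrite mulKmx // SO_unit.
by apply: GM; [apply/GV/RG|apply: RG].
Qed.

End Defs.

Arguments Ogroup {R m}.

(* Main.v *)
(* Let u, t and a = T^(r,v) t be tiles of x, with u of type k and t, a of type j.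
   Some T^g {u, t, a} lies in a supertile phi^n b, and, for every N, x contains a
   copy T^h phi^(N+n) b. Let q be the rotation part of hg. Choose N such that
   phi^N k contains a tile parallel to k: then T^h phi^N T^g u contains a tile
   that is u rotated by q, so that q lies in O_k(x). A tile of type k in
   T^h phi^N T^g t reappears, rotated by q r q^-1, in T^h phi^N T^g a, so that
   q r q^-1 lies in O_k(x) as well, hence so does r.
   That x contains a copy of every supertile follows from local finiteness: the
   finitely many tiles of x which meet a large ball lie, up to a motion, in some
   phi^N (phi^n b), and contain the whole supertile phi^N c which covers the
   centre of the ball. *)

Require Import Defs.
From HB Require Import structures.
From mathcomp Require Import all_boot all_order all_algebra.
From mathcomp Require Import all_classical all_reals all_analysis.
From mathcomp Require Import lra.
Set Implicit Arguments.
Unset Strict Implicit.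
Unset Printing Implicit Defensive.
Import Order.TTheory GRing.Theory Num.Theory.
Import numFieldNormedType.Exports.
Local Open Scope classical_set_scope.
Local Open Scope ring_scope.

(** * Rigid motions: Lipschitz bounds, group laws, action on tilings and patches *)

Section Motions.
Variables (R : realType) (m : nat).
Implicit Types (v w c : 'cV[R]_m) (r : 'M[R]_m) (g h : motion R m)
  (B : set 'cV[R]_m) (t a : polyhedron R m) (A P Q y : set (polyhedron R m)).

Lemma cV_norm_le v e : 0 <= e -> (forall i, `|v i 0| <= e) -> `|v| <= e.
Proof.
move=> e0 ve; rewrite [leLHS]/Num.norm /= mx_normrE.
by apply/bigmax_leP; split=> // -[i j] _ /=; rewrite ord1.
Qed.

Lemma cV_coord_le v i : `|v i 0| <= `|v|.
Proof.
rewrite [leRHS]/Num.norm /= mx_normrE; apply/bigmax_geP; right => /=.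
by exists (i, 0).
Qed.

(** The rows of an orthogonal matrix are unit vectors for the Euclidean norm. *)
Lemma SO_coord_le r i j : SO r -> `|r i j| <= 1.
Proof.
move=> [/matrixP/(_ i i) + _]; rewrite !mxE eqxx.
rewrite (bigD1 j) //= mxE => rE.
have : r i j ^+ 2 <= 1.
  rewrite -[leRHS]rE expr2 lerDl; apply: sumr_ge0 => k _.
  by rewrite mxE -expr2 sqr_ge0.
by rewrite -real_normK ?num_real // -{1}(expr1n _ 2) ler_pXn2r ?nnegrE.
Qed.

(* The norm is the sup norm, for which rotations are not isometries. The factor
   is m + 1 rather than m so that it is positive even when m = 0. *)
Lemma SO_norm_le r v : SO r -> `|r *m v| <= m.+1%:R * `|v|.
Proof.
move=> Sr; apply: cV_norm_le => [|i]; first by rewrite mulr_ge0.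
rewrite mxE (le_trans (ler_norm_sum _ _ _)) //.
apply: (@le_trans _ _ (\sum_(j < m) `|v|)).
  apply: ler_sum => j _; rewrite normrM -[leRHS]mul1r ler_pM //.
    exact: SO_coord_le.
  exact: cV_coord_le.
by rewrite sumr_const card_ord -[leLHS]mulr_natl ler_wpM2r // ler_nat.
Qed.

Definition mmul g h : motion R m := (g.1 *m h.1, g.1 *m h.2 + g.2).
Definition minv g : motion R m := (invmx g.1, - (invmx g.1 *m g.2)).

Lemma move_sub g v w : move g v - move g w = g.1 *m (v - w).
Proof. by rewrite /move opprD addrACA subrr addr0 mulmxBr. Qed.

Lemma moveK g : GE g -> cancel (move g) (move (minv g)).
Proof.
by move=> Gg v; rewrite /move /= mulmxDr addrK mulKmx ?SO_unit.
Qed.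

Lemma moveVK g : GE g -> cancel (move (minv g)) (move g).
Proof.
move=> Gg v; rewrite /move /= mulmxBr !mulmxA mulmxV ?SO_unit //.
by rewrite !mul1mx subrK.
Qed.

Lemma GE_mul g h : GE g -> GE h -> GE (mmul g h).
Proof. by move=> Gg Gh; have [_ _ SM _] := @SO_subgroup R m; exact: SM. Qed.

Lemma GE_inv g : GE g -> GE (minv g).
Proof. by move=> Gg; have [_ _ _ SV] := @SO_subgroup R m; exact: SV. Qed.

Lemma GE_id : GE ((1%:M, 0) : motion R m).
Proof. by have [_ S1 _ _] := @SO_subgroup R m. Qed.

Lemma move_id v : move (1%:M, 0) v = v.
Proof. by rewrite /move /= mul1mx addr0. Qed.

Lemma image_move_id B : move (1%:M, 0) @` B = B.
Proof. by rewrite -[RHS]image_id; apply: eq_imagel => v _; exact: move_id. Qed.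

Lemma Tact_mmul g h t : Tact (mmul g h) t = Tact g (Tact h t).
Proof. by rewrite TactM. Qed.

Lemma Tact_id t : Tact (1%:M, 0) t = t.
Proof.
case: t => B F; rewrite /Tact /= image_move_id; congr Polyhedron.
by rewrite -[RHS]image_id; apply: eq_imagel => C _; exact: image_move_id.
Qed.

Lemma TactK g : GE g -> cancel (Tact g) (Tact (minv g)).
Proof.
by move=> Gg t; rewrite TactM /= mulVmx ?SO_unit // subrr Tact_id.
Qed.

Lemma TpatchM g h P : Tpatch g (Tpatch h P) = Tpatch (mmul g h) P.
Proof. by rewrite /Tpatch image_comp; apply: eq_imagel => t _; exact: TactM. Qed.

Lemma has_type_refl a : has_type a a.
Proof. by exists (1%:M, 0); [exact: GE_id|rewrite Tact_id]. Qed.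

Lemma has_type_Tact g a t : GE g -> has_type a t -> has_type a (Tact g t).
Proof.
move=> Gg [h Gh ->]; exists (mmul g h); [exact: GE_mul|exact: TactM].
Qed.

Lemma move_dist_le g v w : GE g ->
  `|move g v - move g w| <= m.+1%:R * `|v - w|.
Proof. by move=> Gg; rewrite move_sub SO_norm_le. Qed.

(** A quantitative form of being an interior point: the radius is explicit, so that one radius can
    later serve all tiles at once. *)
Definition inball c (e : R) B := forall v, `|v - c| < e -> B v.

Lemma interiorP B v : interior B v <-> exists2 e, 0 < e & inball v e B.
Proof.
rewrite /interior; split=> [/nbhs_ballP [e /= e0 eB]|[e e0 eB]].
  exists e => // w vw; apply: eB; rewrite -ball_normE /ball_ /=.
  by rewrite distrC.
apply/nbhs_ballP; exists e => //= w; rewrite -ball_normE /ball_ /= => vw.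
by apply: eB; rewrite distrC.
Qed.

(** The inverse motion is Lipschitz with constant m + 1 for the sup norm, so it sends the smaller
    ball back into the given one. *)
Lemma inball_move g c e B : GE g -> 0 < e -> inball c e B ->
  inball (move g c) (e / m.+1%:R) (move g @` B).
Proof.
move=> Gg e0 cB v vc; exists (move (minv g) v); last exact: moveVK.
apply: cB; rewrite -{1}(moveK Gg c).
apply: le_lt_trans (move_dist_le _ _ (GE_inv Gg)) _.
by rewrite mulrC -ltr_pdivlMr.
Qed.

Lemma interior_move g B v : GE g -> interior B v ->
  interior (move g @` B) (move g v).
Proof.
move=> Gg /interiorP[e e0 eB]; apply/interiorP; exists (e / m.+1%:R).
  by rewrite divr_gt0.
exact: inball_move.
Qed.

Lemma tiling_Tpatch A g y : GE g -> tiling A y -> tiling A (Tpatch g y).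
Proof.
move=> Gg [yA yT yI]; split.
- move=> _ [t yt <-]; have [b Ab bt] := yA _ yt.
  by exists b => //; exact: has_type_Tact.
- rewrite -subTset => v _.
  have : setT (move (minv g) v) by [].
  rewrite -yT => -[t yt tv]; exists (Tact g t); first by exists t.
  by exists (move (minv g) v) => //; exact: moveVK.
- move=> _ _ [t1 yt1 <-] [t2 yt2 <-] t12.
  have {}t12 : t1 <> t2 by move=> e; apply: t12; rewrite e.
  rewrite -subset0 => v [v1 v2].
  have H t : interior (body (Tact g t)) v -> interior (body t) (move (minv g) v).
    move=> /(interior_move (GE_inv Gg)) /=; rewrite image_comp.
    rewrite (eq_imagel (f' := id)) ?image_id // => w _.
    exact: moveK.
  have : set0 (move (minv g) v) by rewrite -(yI _ _ yt1 yt2 t12); split; exact: H.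
  by [].
Qed.

Lemma patch_Tpatch A g P : GE g -> Defs.patch A P -> Defs.patch A (Tpatch g P).
Proof.
move=> Gg [y yA Py]; exists (Tpatch g y); first exact: tiling_Tpatch.
exact: image_subset.
Qed.

Lemma sub_patch A P Q : P `<=` Q -> Defs.patch A Q -> Defs.patch A P.
Proof. by move=> PQ [y yA Qy]; exists y => //; exact: subset_trans Qy. Qed.

End Motions.

(** Each element has its own threshold, and the maximum of finitely many thresholds serves them all.
    This turns facts about single letters into constants for the whole alphabet. *)
Lemma finite_uniform_bound (R : realType) (T : Type) (A : set T)
    (P : T -> R -> Prop) :
  finite_set A -> (forall a x z, x <= z -> P a x -> P a z) ->
  (forall a, A a -> exists x, P a x) ->
  exists2 x, 0 < x & forall a, A a -> P a x.
Proof.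
move=> finA Pmono PA.
have /choice[f fP] : forall a, exists x, A a -> P a x.
  move=> a; have [Aa|nAa] := pselect (A a).
    by have [x Pax] := PA _ Aa; exists x.
  by exists 0.
have /finite_seqP[s fAs] := finite_image f finA.
have [x x0 xs] : exists2 x : R, 0 < x & forall z, z \in s -> z <= x.
  elim: s {fAs} => [|z s [x x0 xs]]; first by exists 1.
  exists (Num.max z x) => [|w]; first by rewrite lt_max x0 orbT.
  by rewrite inE le_max => /predU1P[->|/xs ->]; rewrite ?lexx ?orbT.
exists x => // a Aa; apply: Pmono (fP _ Aa); apply: xs.
by have : [set` s] (f a) by rewrite -fAs; exists a.
Qed.

(** * Polytopes: boundedness and density of the interior *)

Section Polytopes.
Variables (R : realType) (m : nat).
Implicit Types (v w : 'cV[R]_m) (B : set 'cV[R]_m).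

Lemma convex_hull_bounded k (p : 'I_k -> 'cV[R]_m) v :
  convex_hull p v -> `|v| <= \sum_i `|p i|.
Proof.
move=> [w [w0 w1 ->]]; apply: (le_trans (ler_norm_sum _ _ _)).
apply: ler_sum => i _; rewrite normrZ ger0_norm // ler_piMl //.
by rewrite -w1 (bigD1 i) //= lerDl sumr_ge0.
Qed.

Lemma convex_hull_convex k (p : 'I_k -> 'cV[R]_m) (e : R) v w :
  0 <= e -> e <= 1 -> convex_hull p v -> convex_hull p w ->
  convex_hull p ((1 - e) *: v + e *: w).
Proof.
move=> e0 e1 [a [a0 a1 ->]] [b [b0 b1 ->]].
exists (fun i => (1 - e) * a i + e * b i); split.
- by move=> i; rewrite addr_ge0 // mulr_ge0 ?subr_ge0.
- by rewrite big_split /= -!mulr_sumr a1 b1 !mulr1 subrK.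
- under [RHS]eq_bigr => i _ do rewrite scalerDl -!scalerA.
  by rewrite big_split /= -!scaler_sumr.
Qed.

Lemma polytope_bounded B : polytope_in setT B ->
  exists D, forall v, B v -> `|v| <= D.
Proof.
move=> [n [C [CP ->]]].
have [D D0 DP] : exists2 D : R, 0 < D &
    forall i : 'I_n.+1, [set: 'I_n.+1] i -> forall v, C i v -> `|v| <= D.
  apply: finite_uniform_bound => //.
  - by move=> i x z xz xP v /xP /le_trans; apply.
  - move=> i _; have [[k [p ->]] _ _] := CP i.
    by exists (\sum_i `|p i|) => v; exact: convex_hull_bounded.
by exists D => v [i _ /(DP _ I)].
Qed.

Lemma polytope_interior B : polytope_in setT B -> exists c, interior B c.
Proof.
move=> [n [C [CP ->]]]; have [_ _ [c [_ Cc]]] := CP ord0.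
exists c; apply: (interiorS (bigcup_sup (i := ord0) I)).
by move: Cc; rewrite withinET.
Qed.

(** The point lies in a convex piece that contains a ball. Shrinking that ball towards [v] by a
    homothety of centre [v] keeps it in the piece and brings its centre as close to [v] as
    desired. *)
Lemma polytope_interior_dense B v (e : R) : polytope_in setT B -> B v -> 0 < e ->
  exists2 w, interior B w & `|w - v| < e.
Proof.
move=> [n [C [CP ->]]] [i _ Civ] e0.
have [[k [p CE]] _ [c [_]]] := CP i.
rewrite withinET => /interiorP[d d0 dC].
(* The ratio of the homothety: it is at most 1, and q |c - v| < e even when c = v. *)
pose q := e / (e + `|c - v|).
have ec0 : 0 < e + `|c - v| by rewrite ltr_pwDl.
have q0 : 0 < q by rewrite divr_gt0.
have q1 : q <= 1 by rewrite ler_pdivrMr // mul1r lerDl.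
exists ((1 - q) *: v + q *: c); last first.
  have -> : (1 - q) *: v + q *: c - v = q *: (c - v).
    by rewrite scalerBl scale1r scalerBr addrAC (addrAC v) subrr add0r addrC.
  rewrite normrZ gtr0_norm // mulrAC ltr_pdivrMr //.
  by rewrite ltr_pM2l // ltrDr.
apply: (interiorS (bigcup_sup (i := i) I)).
apply/interiorP; exists (q * d); first by rewrite mulr_gt0.
(* [c'] is the preimage of [z] under the homothety of centre [v] and ratio [q]; it lies in the ball
   of radius [d] about [c]. *)
move=> z zw; pose c' := c + q^-1 *: (z - ((1 - q) *: v + q *: c)).
have -> : z = (1 - q) *: v + q *: c'.
  by rewrite /c' scalerDr scalerA mulfV ?gt_eqF // scale1r addrA addrC subrK.
rewrite CE; apply: convex_hull_convex => //; rewrite ?ltW // -CE //.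
apply: dC; rewrite /c' addrC addKr normrZ gtr0_norm ?invr_gt0 //.
by rewrite mulrC ltr_pdivrMr // mulrC.
Qed.

End Polytopes.

(** * Uniform geometry of tiles and local finiteness of tilings *)

Section Tiles.
Variables (R : realType) (m : nat) (A : set (polyhedron R m)).
Hypothesis hA : alphabet A.
Implicit Types (v w c : 'cV[R]_m) (t a : polyhedron R m).

Lemma tile_diameter : exists2 D, 0 < D & forall a t v w,
  A a -> has_type a t -> body t v -> body t w -> `|v - w| <= D.
Proof.
have [_ finA polyA _] := hA.
have [D D0 DP] : exists2 D : R, 0 < D & forall a, A a ->
    forall v, body a v -> `|v| <= D.
  apply: finite_uniform_bound => //.
  - by move=> a x z xz xP v /xP /le_trans; apply.
  - by move=> a /polyA[/polytope_bounded].
exists (m.+1%:R * (D + D)) => [|a t _ _ Aa [g Gg ->] [v va <-] [w wa <-]].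
  by rewrite mulr_gt0 // addr_gt0.
apply: (le_trans (move_dist_le _ _ Gg)); rewrite ler_wpM2l //.
by rewrite (le_trans (ler_normB _ _)) // lerD // (DP a).
Qed.

Lemma tile_inner_ball : exists2 d, 0 < d & forall a t,
  A a -> has_type a t -> exists c, inball c d (body t).
Proof.
have [_ finA polyA _] := hA.
(* A common lower bound on radii is sought, so the upper bound is taken on their inverses.
   Positivity is part of the property because inversion is monotone only on positive numbers. *)
have [D D0 DP] : exists2 D : R, 0 < D & forall a, A a ->
    0 < D /\ exists c, inball c D^-1 (body a).
  apply: finite_uniform_bound => //.
  - move=> a x z xz [x0 [c cP]]; split; first exact: lt_le_trans xz.
    exists c => v vc; apply: cP; apply: (lt_le_trans vc).
    by rewrite lef_pV2 // posrE (lt_le_trans x0).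
  - move=> a /polyA[/polytope_interior[c /interiorP[e e0 ce]] _ _ _ _].
    exists e^-1; split; first by rewrite invr_gt0.
    by exists c; rewrite invrK.
exists (D^-1 / m.+1%:R) => [|a t Aa [g Gg ->]].
  by rewrite divr_gt0 ?invr_gt0.
have [_ [c cP]] := DP _ Aa.
by exists (move g c); apply: inball_move; rewrite ?invr_gt0.
Qed.

Lemma tile_interior_dense a t v (e : R) :
  A a -> has_type a t -> body t v -> 0 < e ->
  exists2 w, interior (body t) w & `|w - v| < e.
Proof.
have [_ _ polyA _] := hA.
move=> Aa [g Gg ->] [v' av' <-] e0; have [pa _ _ _ _] := polyA _ Aa.
have e'0 : 0 < e / m.+1%:R by rewrite divr_gt0.
have [w wa wv] := polytope_interior_dense pa av' e'0.
exists (move g w); first exact: interior_move.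
apply: le_lt_trans (move_dist_le _ _ Gg) _.
by rewrite mulrC -ltr_pdivlMr.
Qed.

Lemma tile_interior_neq0 a t : A a -> has_type a t ->
  exists v, interior (body t) v.
Proof.
have [d d0 dP] := tile_inner_ball; move=> Aa ta; have [c cP] := dP _ _ Aa ta.
by exists c; apply/interiorP; exists d.
Qed.

(* The cells of a fine enough grid contain the centre of at most one of the
   pairwise disjoint inner balls. *)
Lemma tiling_locally_finite y (L : R) : tiling A y ->
  finite_set [set t | y t /\ exists2 v, body t v & `|v| <= L].
Proof.
move=> [yA _ yI].
have [D D0 DP] := tile_diameter; have [d d0 dP] := tile_inner_ball.
have /choice[c cP] : forall t, exists c, y t -> inball c d (body t).
  move=> t; have [yt|nyt] := pselect (y t); last by exists 0.
  by have [a Aa ta] := yA _ yt; have [c cP] := dP _ _ Aa ta; exists c.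
have cb t : y t -> body t (c t).
  by move=> yt; apply: cP => //; rewrite subrr normr0.
(* The side [e] of the grid is half the inner radius [d]. *)
set P := [set t | _]; have [e e0 de] : exists2 e, 0 < e & d = e + e.
  by exists (d / 2); [rewrite divr_gt0|exact: splitr].
have cL t i : P t ->
    0 <= c t i 0 + (D + L) /\ c t i 0 + (D + L) <= (D + L) *+ 2.
  move=> [yt [v tv vL]]; have [a Aa ta] := yA _ yt.
  have : `|c t i 0| <= D + L.
    apply: (le_trans (cV_coord_le _ _)); rewrite -[c t](subrK v).
    rewrite (le_trans (ler_normD _ _)) // lerD //.
    exact: DP Aa ta (cb _ yt) tv.
  by rewrite ler_norml mulr2n => /andP[? ?]; split; lra.
(* The shifted coordinates of the centres lie between 0 and 2(D + L), so no cell index exceeds [K]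
   and [inord] alters none. *)
pose K := Num.truncn ((D + L) *+ 2 / e).
pose cell t : {ffun 'I_m -> 'I_K.+1} :=
  [ffun i => inord (Num.truncn ((c t i 0 + (D + L)) / e))].
suff cellI : {in P &, injective cell}.
  have := inj_card_eq cellI; rewrite card_eq_le => /andP[_ cellP].
  have fin : finite_set (cell @` P) by exact: finite_finset.
  exact: card_le_finite cellP fin.
move=> t s; rewrite !inE => Pt Ps ts.
have cts : `|c s - c t| <= e.
  apply: cV_norm_le => [|i]; first exact: ltW.
  have [ct0 ctL] := cL _ i Pt; have [cs0 csL] := cL _ i Ps.
  have trE : Num.truncn ((c t i 0 + (D + L)) / e) =
      Num.truncn ((c s i 0 + (D + L)) / e).
    have /(congr1 val) := congr1 (fun f : {ffun _ -> _} => f i) ts.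
    by rewrite !ffunE /= !inordK // ltnS le_truncn // ler_wpM2r // invr_ge0 ltW.
  have te0 : 0 <= (c t i 0 + (D + L)) / e by rewrite divr_ge0 // ltW.
  have se0 : 0 <= (c s i 0 + (D + L)) / e by rewrite divr_ge0 // ltW.
  have /andP[] := truncn_itv te0; have /andP[] := truncn_itv se0.
  rewrite -trE -natr1; set N := Num.truncn _.
  rewrite !ler_pdivlMr // !ltr_pdivrMr // !mulrDl !mul1r => *.
  by rewrite !mxE ler_norml; apply/andP; split; lra.
have [[yt _] [ys _]] := (Pt, Ps); apply: contrapT => nts.
(* The two centres are at distance at most [e], so the ball of radius [e] about [c s] lies in the
   ball of radius d = 2e about [c t]. *)
have : (interior (body t) `&` interior (body s)) (c s).
  split; apply/interiorP; last by exists d => //; exact: cP.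
  exists e => // z zs; apply: cP => //.
  rewrite -[z](subrK (c s)) -addrA (le_lt_trans (ler_normD _ _)) //.
  by rewrite de ltr_leD.
by rewrite yI.
Qed.

End Tiles.

(** * Iterates of the substitution, supertiles and their copies in a tiling *)

Section Substitution.
Variables (R : realType) (m : nat) (A : set (polyhedron R m)) (l : R)
  (phi : set (polyhedron R m) -> set (polyhedron R m)).
Hypotheses (hA : alphabet A) (hphi : substitution A l phi).
Implicit Types (s t a b : polyhedron R m) (g h : motion R m)
  (P Q y : set (polyhedron R m)).

Local Notation patch := (@Defs.patch R m A).

Lemma iter_patch n P : patch P -> patch (iter n phi P).
Proof. by move=> PA; elim: n => //= n; have [_ [+ _] _ _ _] := hphi; apply. Qed.

Lemma iter_bigcup n P : patch P ->
  iter n phi P = \bigcup_(t in P) iter n phi [set t].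
Proof.
move=> PA; elim: n => [|n IH]; first by rewrite /= (bigcup_imset1 P id) image_id.
have [_ [_ phiU] _ _ _] := hphi.
rewrite [LHS]/= phiU; last exact: iter_patch.
rewrite IH bigcup_bigcup; apply: eq_bigcupr => t Pt /=.
by rewrite -phiU //; apply/iter_patch/(sub_patch _ PA) => _ ->.
Qed.

Lemma iter_subset n P Q : patch Q -> P `<=` Q -> iter n phi P `<=` iter n phi Q.
Proof.
move=> QA PQ; rewrite (iter_bigcup _ QA) iter_bigcup; last exact: sub_patch QA.
exact: bigcup_subset.
Qed.

Lemma iter_set1_subset n t Q : patch Q -> Q t ->
  iter n phi [set t] `<=` iter n phi Q.
Proof. by move=> QA Qt; apply: iter_subset => // _ ->. Qed.

(** Conjugation by a stretching affects the translation part only; this is what lets rotations be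
    followed through iterates of [phi]. *)
Lemma iter_stretch_rot n g : (iter n (stretch l) g).1 = g.1.
Proof. by elim: n. Qed.

Lemma iter_stretch_GE n g : GE g -> GE (iter n (stretch l) g).
Proof. by rewrite /GE /= iter_stretch_rot. Qed.

Lemma iter_Tpatch n g P : GE g -> patch P ->
  iter n phi (Tpatch g P) = Tpatch (iter n (stretch l) g) (iter n phi P).
Proof.
move=> Gg PA; elim: n => //= n ->.
have [_ _ phiT _ _] := hphi; apply: phiT; last exact: iter_patch.
exact: iter_stretch_GE.
Qed.

Lemma iter_Tact n g t : GE g -> patch [set t] ->
  iter n phi [set Tact g t] =
    Tpatch (iter n (stretch l) g) (iter n phi [set t]).
Proof. by move=> Gg tA; rewrite -iter_Tpatch // /Tpatch image_set1. Qed.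

Lemma support_Tpatch g P : Defs.support (Tpatch g P) = move g @` Defs.support P.
Proof. by rewrite /Defs.support /Tpatch bigcup_image image_bigcup. Qed.

Lemma patch_type P t : patch P -> P t -> exists2 a, A a & has_type a t.
Proof. by move=> [y [yA _ _] Py] /Py /yA. Qed.

Variables (y : set (polyhedron R m)) (hy : substitution_tiling A phi y).

Lemma sub_tiling_patch P : P `<=` y -> patch P.
Proof. by move=> Py; exists y => //; case: hy. Qed.

(** Some tile of [y] moves back to a letter [b], so [[set b]] is a patch; then [phi [set b]] is a
    patch with a tile of type [a], which moves back to [a]. *)
Lemma letter_patch a : A a -> patch [set a].
Proof.
move=> Aa; have [yA yT _] := hy.1.
have [t yt _] : (\bigcup_(t in y) body t) 0 by rewrite yT.
have [b Ab [g Gg te]] := yA _ yt.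
have bP : patch [set b].
  rewrite -(TactK Gg b) -te -image_set1; apply: patch_Tpatch (GE_inv Gg) _.
  by apply: sub_tiling_patch => _ ->.
have [_ [phiP _] _ _ phit] := hphi.
have [s bs [h Gh se]] := phit b a Ab Aa.
rewrite -(TactK Gh a) -se -image_set1; apply: patch_Tpatch (GE_inv Gh) _.
by apply: (sub_patch _ (phiP _ bP)) => _ ->.
Qed.

Lemma tile_patch a t : A a -> has_type a t -> patch [set t].
Proof.
by move=> Aa [g Gg ->]; rewrite -image_set1; exact: patch_Tpatch (letter_patch Aa).
Qed.

Lemma phi_has_type t a b : A a -> A b -> has_type a t ->
  exists2 s, phi [set t] s & has_type b s.
Proof.
move=> Aa Ab [g Gg ->]; have [_ _ _ _ phit] := hphi.
have [s as_ bs] := phit a b Aa Ab.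
have := iter_Tact 1 Gg (letter_patch Aa) => /= ->.
by exists (Tact (stretch l g) s); [exists s|exact: has_type_Tact].
Qed.

Lemma iter_has_type n t a b : (0 < n)%N -> A a -> A b -> has_type a t ->
  exists2 s, iter n phi [set t] s & has_type b s.
Proof.
case: n => // n _ Aa; elim: n => [|n IH] in b * => Ab ta.
  exact: phi_has_type ta.
have [s ts as_] := IH a Aa ta; have [u su bu] := phi_has_type Aa Ab as_.
exists u => //; apply: (iter_set1_subset (n := 1) _ ts) => //.
exact/iter_patch/(tile_patch Aa).
Qed.

Lemma supertile_diameter n : (0 < n)%N -> exists2 D, 0 < D & forall a t v w,
  A a -> has_type a t -> Defs.support (iter n phi [set t]) v ->
  Defs.support (iter n phi [set t]) w -> `|v - w| <= D.
Proof.
move=> n0; have [l1 _ _ phis _] := hphi.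
have l0 : 0 < l by rewrite (lt_trans ltr01).
have [D D0 DP] := tile_diameter hA.
exists (m.+1%:R * (m.+1%:R * (l ^+ n * D))).
  by rewrite !mulr_gt0 // exprn_gt0.
move=> a t v w Aa [g Gg ->]; rewrite iter_Tact //; last exact: letter_patch.
have [[h Gh suppE] _] := phis a n Aa n0.
rewrite support_Tpatch suppE => -[_ [_ [v' av' <-] <-] <-].
move=> [_ [_ [w' aw' <-] <-] <-].
apply: (le_trans (move_dist_le _ _ _)); first exact: iter_stretch_GE.
rewrite ler_wpM2l //; apply: (le_trans (move_dist_le _ _ Gh)).
rewrite ler_wpM2l // -scalerBr normrZ gtr0_norm ?exprn_gt0 //.
rewrite ler_pM2l ?exprn_gt0 //.
exact: DP Aa (has_type_refl a) av' aw'.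
Qed.

(** The order of the supertile given by the definition of [X_phi] is not under control, but it can
    be raised by [k]: phi^k a contains a tile of type [a], hence phi^(n+k) a contains a copy of
    phi^n a. *)
Lemma finite_subpatch_deep P k : finite_set P -> P `<=` y -> (0 < k)%N ->
  exists n a g,
    [/\ A a, GE g & Tpatch g P `<=` iter k phi (iter n phi [set a])].
Proof.
move=> finP Py k0; have [n [a [g [n0 Aa Gg Pa]]]] := hy.2 P finP Py.
have [s as_ [h Gh se]] := iter_has_type k0 Aa Aa (has_type_refl a).
have Gh' := iter_stretch_GE n Gh.
exists n, a, (mmul (iter n (stretch l) h) g); split=> //; first exact: GE_mul.
(* Exchanging the iterates puts phi^k a inside, where the tile [s] of type [a] lies. *)
rewrite -iterD addnC iterD.
apply: subset_trans (iter_set1_subset (iter_patch _ (letter_patch Aa)) as_).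
rewrite se iter_Tact //; last exact: letter_patch.
by rewrite -TpatchM; exact: image_subset.
Qed.

(** Since interiors are dense in tiles, [t] has an interior point so near [v] that it is also
    interior to [s]. *)
Lemma patch_interior_uniq P s t v : patch P -> P s -> P t ->
  interior (body s) v -> body t v -> s = t.
Proof.
move=> PA Ps Pt sv tv; apply: contrapT => nst.
have [a Aa at_] := patch_type PA Pt.
case: PA => z [_ _ zI] Pz; have /interiorP[e e0 es] := sv.
have [w tw wv] := tile_interior_dense hA Aa at_ tv e0.
have sw : interior (body s) w.
  apply/interiorP; exists (e - `|w - v|); first by rewrite subr_gt0.
  move=> u uw; apply: es; rewrite -[u](subrK w) -addrA.
  by rewrite (le_lt_trans (ler_normD _ _)) // -ltrBrDr.
have : set0 w by rewrite -(zI _ _ (Pz _ Ps) (Pz _ Pt) nst).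
by [].
Qed.

Lemma tiling_contains_supertile k : (0 < k)%N -> exists c a h,
  [/\ A a, has_type a c, GE h & Tpatch h (iter k phi [set c]) `<=` y].
Proof.
move=> k0; have [D D0 DP] := supertile_diameter k0.
have [_ yT _] := hy.1.
(* A motion expands distances by at most m + 1, so this ball contains the image under [minv g] of
   any order-[k] supertile that contains [move g 0]. *)
pose P := [set t | y t /\ exists2 v, body t v & `|v| <= m.+1%:R * D].
have finP : finite_set P by exact: (tiling_locally_finite hA _ hy.1).
have Py : P `<=` y by move=> t [].
have [n [a [g [Aa Gg Pa]]]] := finite_subpatch_deep finP Py k0.
have [t yt t0] : (\bigcup_(t in y) body t) 0 by rewrite yT.
have Pt : P t.
  by split=> //; exists 0 => //; rewrite normr0 mulr_ge0 // ltW.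
have naP := iter_patch n (letter_patch Aa); have knaP := iter_patch k naP.
have : iter k phi (iter n phi [set a]) (Tact g t) by apply: Pa; exists t.
(* [c] is the tile of phi^n a whose supertile phi^k c contains [Tact g t], hence the point
   [move g 0]. *)
rewrite iter_bigcup // => -[c nac kct].
have [b Ab bc] := patch_type naP nac.
exists c, b, (minv g); split=> //; first exact: GE_inv.
have ck := iter_set1_subset (n := k) naP nac.
(* The tile [t'] of [y] that covers the preimage of an interior point of [s] belongs to [P]. Hence
   [Tact g t'] is a tile of the same patch as [s] and meets its interior, so it equals [s]. *)
move=> _ [s cs <-]; have [d Ad ds] := patch_type knaP (ck _ cs).
have [q sq] := tile_interior_neq0 hA Ad ds.
have [t' yt' t'q] : (\bigcup_(t in y) body t) (move (minv g) q) by rewrite yT.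
have Pt' : P t'.
  split=> //; exists (move (minv g) q) => //.
  rewrite -[X in `|X|]subr0 -[X in _ - X](moveK Gg 0).
  apply: (le_trans (move_dist_le _ _ (GE_inv Gg))); rewrite ler_wpM2l //.
  apply: DP Ab bc _ _; first by exists s => //; exact: interior_subset.
  by exists (Tact g t) => //; exists 0.
rewrite (patch_interior_uniq (t := Tact g t') knaP (ck _ cs) _ sq).
- by rewrite TactK.
- by apply: Pa; exists t'.
- by exists (move (minv g) q) => //; exact: moveVK.
Qed.

(** A supertile of order k + 1, whatever its type, contains supertiles of order [k] of all types,
    because [phi] of any tile contains every type. *)
Lemma tiling_contains_iter k b : A b ->
  exists2 h, GE h & Tpatch h (iter k phi [set b]) `<=` y.
Proof.
move=> Ab; have [c [a [h [Aa ac Gh cy]]]] := tiling_contains_supertile (ltn0Sn k).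
have [s cs [f Gf se]] := phi_has_type Aa Ab ac.
exists (mmul h (iter k (stretch l) f)).
  by apply: GE_mul => //; exact: iter_stretch_GE.
rewrite -TpatchM -iter_Tact //; last exact: letter_patch.
apply: subset_trans cy; apply: image_subset; rewrite iterSr -se.
apply: iter_set1_subset => //.
exact: (iter_patch 1 (tile_patch Aa ac)).
Qed.

End Substitution.

(** * Membership in the groups of relative rotations *)

Section RotationGroups.
Variables (R : realType) (m : nat).
Implicit Types (y : set (polyhedron R m)) (s t k : polyhedron R m).

Lemma Ogroup_rot k y s t g : y s -> y t -> has_type k s -> GE g ->
  t = Tact g s -> Ogroup k y g.1.
Proof.
move=> ys yt ks Gg te; exists t; split=> //.
  by rewrite te; exact: has_type_Tact.
apply: sub_gen_smallest; split=> //; exists s; split=> //; exists g.2.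
by rewrite te TactM /= mul1mx mulmx0 add0r; case: (g).
Qed.

Lemma Ogroup_subgroup k y s : y s -> has_type k s -> subgroup_SO (Ogroup k y).
Proof.
by move=> ys ks; rewrite (Ogroup_indep ys ks); apply: gen_subgroup => r [].
Qed.

End RotationGroups.

(** * Inclusion between the rotation groups of two tile types *)

Section Inclusion.
Variables (R : realType) (m : nat) (A : set (polyhedron R m)) (l : R)
  (phi : set (polyhedron R m) -> set (polyhedron R m)).
Hypotheses (hA : alphabet A) (hphi : substitution A l phi)
  (hpar : forall a, A a -> exists2 n, (0 < n)%N &
    exists a', [/\ iter n phi [set a] a', has_type a a' & Defs.parallel a a']).

Lemma Ogroup_subset y j k : substitution_tiling A phi y -> A j -> A k ->
  Ogroup j y `<=` Ogroup k y.
Proof.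
move=> hy Aj Ak.
(* Order 0 provides a tile of type [k] in [y]. *)
have [h0 Gh0 ky] := tiling_contains_iter hA hphi hy 0 Ak.
pose u := Tact h0 k.
have yu : y u by apply: ky; exists k.
have ku : has_type k u by exists h0.
have OG := Ogroup_subgroup yu ku; have [_ _ OM OV] := OG.
(* As [Ogroup k y] is a subgroup, it is enough to treat the generators of the group of [j]. *)
move=> r0 [a [ya ja]]; move: r0; apply: smallest_sub => // r.
move=> [Sr [t [yt jt [v ae]]]].
have {}ae : a = Tact (r, v) t by rewrite ae TactM /= mul1mx mulmx0 add0r.
pose P := [set t; a; u].
have finP : finite_set P by rewrite !finite_setU; do !split; exact: finite_set1.
have Py : P `<=` y by move=> _ [[]|] ->.
have [n [b [g [_ Ab Gg Pb]]]] := hy.2 P finP Py.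
have [N N0 [k' [Nk kk' [w k'e]]]] := hpar Ak.
have [h Gh hNy] := tiling_contains_iter hA hphi hy (N + n) Ab.
have bP := letter_patch hphi hy Ab.
have nbP := iter_patch hphi n bP.
have inY p s : P p -> iter N phi [set Tact g p] s -> y (Tact h s).
  move=> Pp ps; apply: hNy; exists s => //; rewrite iterD.
  apply: (iter_set1_subset hphi nbP) ps; first by apply: Pb; exists p.
pose q := h.1 *m g.1.
have Oq : Ogroup k y q.
  pose f := mmul g h0; have Gf : GE f by exact: GE_mul.
  (* From right to left: [u] goes back to the letter [k], is translated to [k'], and is carried by
     the stretched [f] and [h] into [y]. The rotation [h0.1] cancels and leaves [q]. *)
  pose e := mmul (mmul (mmul h (iter N (stretch l) f)) (1%:M, w)) (minv h0).
  have -> : q = e.1.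
    by rewrite /= iter_stretch_rot mulmx1 /= !mulmxA mulmxK // SO_unit.
  have ue : Tact e u = Tact h (Tact (iter N (stretch l) f) k').
    by rewrite k'e !Tact_mmul TactK.
  apply: (Ogroup_rot yu _ ku _ erefl).
  - rewrite ue; apply: (inY u); first by right.
    rewrite /u -Tact_mmul -/f (iter_Tact hphi) //; first by exists k'.
    exact: (letter_patch hphi hy Ak).
  - apply: GE_mul (GE_inv Gh0); apply: GE_mul; last exact: GE_id.
    by apply: GE_mul (iter_stretch_GE _ _ _).
have qu : q \in unitmx by rewrite unitmx_mul !SO_unit.
have Oqr : Ogroup k y (q *m r *m invmx q).
  have Gtg : has_type j (Tact g t) by exact: has_type_Tact.
  have [s ts ks] := iter_has_type hphi hy N0 Aj Ak Gtg.
  (* [f] takes [Tact g t] to [Tact g a], so its stretched form takes phi^N of the former to phi^N of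
     the latter. Conjugating by [h] transfers this to [y], with rotation q r q^-1. *)
  pose f := mmul (mmul g (r, v)) (minv g).
  have Gf : GE f by apply: GE_mul (GE_inv Gg); exact: GE_mul.
  pose e := mmul (mmul h (iter N (stretch l) f)) (minv h).
  have -> : q *m r *m invmx q = e.1.
    apply: (can_inj (mulmxK qu)); rewrite mulmxKV //= iter_stretch_rot /= /q.
    by rewrite !mulmxA !(mulmxKV (SO_unit _)).
  apply: (@Ogroup_rot _ _ k y (Tact h s) (Tact e (Tact h s))) => //.
  - by apply: (inY t) => //; left; left.
  - rewrite !Tact_mmul TactK //.
    apply: (inY a); first by left; right.
    have -> : Tact g a = Tact f (Tact g t) by rewrite ae !Tact_mmul TactK.
    by rewrite (iter_Tact hphi) //; [exists s|exact: (tile_patch hphi hy Aj)].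
  - exact: has_type_Tact.
  - apply: GE_mul (GE_inv Gh).
    by apply: GE_mul (iter_stretch_GE _ _ _).
move: {inY} q qu Oq Oqr => q qu Oq Oqr.
have -> : r = invmx q *m (q *m r *m invmx q) *m q.
  by rewrite -!mulmxA mulKmx // mulmxA mulmxKV.
exact: (OM _ _ (OM _ _ (OV _ Oq) Oqr) Oq).
Qed.

End Inclusion.

Theorem lemma3 (R : realType) (m : nat) (A : set (polyhedron R m))
    (l : R) (phi : set (polyhedron R m) -> set (polyhedron R m))
    (hA : alphabet A) (hphi : substitution A l phi)
    (hpar : forall a, A a -> exists2 n, (0 < n)%N &
       exists a', [/\ iter n phi [set a] a', has_type a a' & parallel a a']) :
  forall (x : set (polyhedron R m)) (j k : polyhedron R m),
    substitution_tiling A phi x -> A j -> A k -> Ogroup j x = Ogroup k x.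
Proof.
move=> x j k hx Aj Ak.
by apply/seteqP; split; apply: (Ogroup_subset hA hphi hpar hx).
Qed.
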